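(* Let $(\mathfrak g,d_{\mathfrak g},[\cdot,\cdot]_{\mathfrak g})$ and $(\mathfrak h,d_{\mathfrak h},[\cdot,\cdot]_{\mathfrak h})$ be strict Lie 2-algebras such that $\mathrm{Cen}(\mathfrak h)=0$. Then isomorphism classes of non-abelian extensions of $\mathfrak g$ by $\mathfrak h$ correspond bijectively (by sending an extension to its induced homomorphism) to strict Lie 2-algebra homomorphisms $\bar\mu:\mathfrak g\to\mathrm{SOut}(\mathfrak h)$.
   Context: All vector spaces are over a fixed ground field $\mathbb K$. **Strict Lie 2-algebras.** A strict Lie 2-algebra is a graded vector space $\mathfrak g=\mathfrak g_1\oplus\mathfrak g_0$ with a linear map $d_{\mathfrak g}:\mathfrak g_1\to\mathfrak g_0$ and a skew-symmetric bilinear bracket $[\cdot,\cdot]_{\mathfrak g}:\mathfrak g_i\wedge\mathfrak g_j\to\mathfrak g_{i+j}$, $0\le i+j\le 1$ (so $[x,a]=-[a,x]$ for $x\in\mathfrak g_0,a\in\mathfrak g_1$), such that for $x,y,z\in\mathfrak g_0$, $a,b\in\mathfrak g_1$: $d[x,a]=[x,da]$; $[da,b]=[a,db]$; $[[x,y],z]+[[y,z],x]+[[z,x],y]=0$; $[[x,y],a]+[[y,a],x]+[[a,x],y]=0$. A strict homomorphism $f:\mathfrak g\to\mathfrak g'$ is a pair of linear maps $f_0:\mathfrak g_0\to\mathfrak g_0'$, $f_1:\mathfrak g_1\to\mathfrak g_1'$ with $d_{\mathfrak g'}f_1=f_0d_{\mathfrak g}$, $f_0[x,y]=[f_0x,f_0y]$,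 $f_1[x,a]=[f_0x,f_1a]$. **Derivations.** The strict Lie 2-algebra $\mathrm{SDer}(\mathfrak h)$ has degree-0 part $\mathrm{SDer}^0(\mathfrak h)$ consisting of pairs $(X_0,X_1)\in\mathrm{End}(\mathfrak h_0)\oplus\mathrm{End}(\mathfrak h_1)$ with $X_0d_{\mathfrak h}=d_{\mathfrak h}X_1$, $X_0[u,v]=[X_0u,v]+[u,X_0v]$, $X_1[u,m]=[X_0u,m]+[u,X_1m]$, and degree-1 part $\mathrm{SDer}^1(\mathfrak h)$ consisting of linear maps $\Theta:\mathfrak h_0\to\mathfrak h_1$ with $\Theta[u,v]=[\Theta u,v]+[u,\Theta v]$ ($u,v\in\mathfrak h_0$, $m\in\mathfrak h_1$). Its differential is $\delta(\Theta)=(d_{\mathfrak h}\Theta,\Theta d_{\mathfrak h})$ and its bracket is $[(X_0,X_1),(Y_0,Y_1)]_C=([X_0,Y_0],[X_1,Y_1])$, $[(X_0,X_1),\Theta]_C=X_1\Theta-\Theta X_0=-[\Theta,(X_0,X_1)]_C$. The adjoint homomorphism $\mathfrak h\to\mathrm{SDer}(\mathfrak h)$ is $\mathrm{ad}_0(u)=([u,\cdot]|_{\mathfrak h_0},[u,\cdot]|_{\mathfrak h_1})$, $\mathrm{ad}_1(m)(u)=[m,u]$. Its kernel is the center $\mathrm{Cen}(\mathfrak h)=\ker\mathrm{ad}_1\oplus\ker\mathrm{ad}_0$. Its image $\mathrm{SInn}(\mathfrak h)$ is an ideal of $\mathrm{SDer}(\mathfrak h)$, and $\mathrm{SOut}(\mathfrak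 h)=\mathrm{SDer}(\mathfrak h)/\mathrm{SInn}(\mathfrak h)$ with quotient map $\pi=(\pi_0,\pi_1)$ and induced strict Lie 2-algebra structure. **Extensions.** A non-abelian extension of $\mathfrak g$ by $\mathfrak h$ is a strict Lie 2-algebra $\hat{\mathfrak g}$ with strict homomorphisms $i:\mathfrak h\to\hat{\mathfrak g}$, $p:\hat{\mathfrak g}\to\mathfrak g$ such that $0\to\mathfrak h_k\xrightarrow{i_k}\hat{\mathfrak g}_k\xrightarrow{p_k}\mathfrak g_k\to0$ is exact for $k=0,1$. Two extensions $(\hat{\mathfrak g},i,p)$, $(\tilde{\mathfrak g},j,q)$ are isomorphic if there is a strict homomorphism $F:\hat{\mathfrak g}\to\tilde{\mathfrak g}$ with $F\circ i=j$, $q\circ F=p$ (this is an equivalence relation). **Induced homomorphism.** Given an extension, identify $\mathfrak h$ with $i(\mathfrak h)$, choose linear sections $\sigma_k:\mathfrak g_k\to\hat{\mathfrak g}_k$ of $p_k$, and put $\mu_0(x)=([\sigma_0(x),\cdot]|_{\mathfrak h_0},[\sigma_0(x),\cdot]|_{\mathfrak h_1})\in\mathrm{SDer}^0(\mathfrak h)$ for $x\in\mathfrak g_0$ and $\mu_1(a)=[\sigma_1(a),\cdot]|_{\mathfrak h_0}\in\mathrm{SDer}^1(\mathfrak h)$ for $a\in\mathfrak g_1$. The induced homomorphism is $\bar\mu=(\pi_0\circ\mu_0,\pi_1\circ\mu_1)$; it does not depend on $\sigma$. *)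

(* Defs.v *)
From HB Require Import structures.
From mathcomp Require Import all_boot all_algebra.
From mathcomp Require Import all_classical.

Set Implicit Arguments.
Unset Strict Implicit.
Unset Printing Implicit Defensive.

Import GRing.Theory.
Local Open Scope ring_scope.
Local Open Scope classical_set_scope.
Local Open Scope quotient_scope.

(* [S] carrying the proof that it is a subspace, as a key for instances. *)
Definition subspace (K : fieldType) (V : lmodType K) (S : {pred V})
  (hS : GRing.submod_closed S) : V -> bool := S.

HB.instance Definition _ (K : fieldType) (V : lmodType K) (S : {pred V})
    (hS : GRing.submod_closed S) :=
  GRing.isZmodClosed.Build V (subspace hS) (GRing.submod_closedB hS).

Section LinearQuotient.
Variables (K : fieldType) (V : lmodType K) (S : {pred V}).
Hypothesis hS : GRing.submod_closed S.

Let Q := Quotient.quot (GRing.ZmodClosed.clone V (subspace hS) _).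
Definition lquot : Type := Q.
HB.instance Definition _ := GRing.Zmodule.on lquot.

Definition lpi (x : V) : lquot := \pi_Q x.
Definition lrepr (p : lquot) : V := repr (p : Q).

Lemma lreprK : cancel lrepr lpi.
Proof. by move=> p; rewrite /lpi /lrepr reprK. Qed.

Lemma lpi_eq x y : (lpi x == lpi y) = (x - y \in S).
Proof. by rewrite /lpi -Quotient.idealrBE. Qed.

Lemma lpi_eqP x y : x - y \in S -> lpi x = lpi y.
Proof. by rewrite -lpi_eq => /eqP. Qed.

Lemma lreprP x : lrepr (lpi x) - x \in S.
Proof. by rewrite -lpi_eq lreprK. Qed.

Lemma lpiD x y : lpi (x + y) = lpi x + lpi y.
Proof. by rewrite /lpi raddfD. Qed.

Lemma lpiN x : lpi (- x) = - lpi x.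
Proof. by rewrite /lpi raddfN. Qed.

Definition lscale (a : K) (p : lquot) : lquot := lpi (a *: lrepr p).

Lemma submodZ a x : x \in S -> a *: x \in S.
Proof. by case: hS => S0 Sl Sx; rewrite -[a *: x]addr0 Sl. Qed.

Lemma lscaleE a x : lscale a (lpi x) = lpi (a *: x).
Proof. by apply: lpi_eqP; rewrite -scalerBr submodZ ?lreprP. Qed.

Lemma lscaleA a b v : lscale a (lscale b v) = lscale (a * b) v.
Proof. by rewrite -[v]lreprK !lscaleE scalerA. Qed.

Lemma lscale1 : left_id 1 lscale.
Proof. by move=> v; rewrite -[v]lreprK lscaleE scale1r. Qed.

Lemma lscaleDr : right_distributive lscale +%R.
Proof.
by move=> a u v; rewrite -[u]lreprK -[v]lreprK -lpiD !lscaleE scalerDr lpiD.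
Qed.

Lemma lscaleDl v : {morph lscale^~ v : a b / a + b}.
Proof. by move=> a b; rewrite -[v]lreprK !lscaleE scalerDl lpiD. Qed.

HB.instance Definition _ :=
  GRing.Zmodule_isLmodule.Build K lquot lscaleA lscale1 lscaleDr lscaleDl.

Lemma lpi_linear : linear lpi.
Proof. by move=> a x y; rewrite lpiD -lscaleE. Qed.

HB.instance Definition _ :=
  GRing.isLinear.Build K V lquot *:%R lpi lpi_linear.

End LinearQuotient.

Section LinearSection.
Variables (K : fieldType) (U V : lmodType K) (p : {linear U -> V}).
Hypothesis p_surj : forall y, exists x, p x = y.

(* The image of a section is a maximal subspace meeting [ker p] trivially. *)
Let meets_ker_trivially (A : set U) :=
  (forall a x y, A x -> A y -> A (a *: x + y)) /\
  (forall x, A x -> p x = 0 -> x = 0).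

Lemma linear_section_exists : exists s : {linear V -> U}, cancel s p.
Proof.
have chain F : F `<=` meets_ker_trivially -> total_on F subset ->
    meets_ker_trivially (\bigcup_(X in F) X).
  move=> FP Ftot; split.
    move=> a x y [X FX Xx] [Y FY Yy].
    have [XY|YX] := Ftot _ _ FX FY.
      by exists Y => //; apply: (FP _ FY).1 => //; exact: XY.
    by exists X => //; apply: (FP _ FX).1 => //; exact: YX.
  by move=> x [X FX Xx]; exact: (FP _ FX).2.
have [A [[Alin Aker] Amax]] := Zorn_bigcup chain.
have A0 : A 0.
  have nA : A !=set0.
    apply/set0P/eqP => A_eq0; apply: (Amax [set 0]).
      split; last by move=> /(_ 0 erefl); rewrite A_eq0.
      by rewrite A_eq0; apply: sub0set.
    split; first by move=> a x y -> ->; rewrite scaler0 addr0.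
    by move=> x ->.
  by have [x Ax] := nA; have := Alin (-1) _ _ Ax Ax; rewrite scaleN1r addNr.
have AZ a x : A x -> A (a *: x).
  by move=> Ax; have := Alin a _ _ Ax A0; rewrite addr0.
have Asurj y : exists x, A x /\ p x = y.
  apply: contrapT => nhit; have [x0 px0] := p_surj y.
  pose B := [set z | exists a c, A a /\ z = a + c *: x0].
  apply: (Amax B); last first.
    split.
      move=> k _ _ [a [c [Aa ->]]] [b [e [Ab ->]]].
      exists (k *: a + b), (k * c + e); split; first exact: Alin.
      by rewrite scalerDr scalerA scalerDl addrACA.
    move=> _ [a [c [Aa ->]]]; rewrite linearD linearZ /= px0.
    have [-> |c0] := eqVneq c 0.
      by rewrite !scale0r !addr0; exact: Aker.
    move=> eq0; case: nhit; exists (- c^-1 *: a); split; first exact: AZ.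
    rewrite linearZ /=; move/eqP: eq0; rewrite addr_eq0 => /eqP ->.
    by rewrite scalerN scaleNr opprK scalerA mulVf// scale1r.
  split; first by move=> a Aa; exists a, 0; rewrite scale0r addr0.
  move=> BA; apply: nhit; exists x0; split => //; apply: BA.
  by exists 0, 1; rewrite add0r scale1r.
have [s sP] := choice Asurj.
have Auniq x y : A x -> A y -> p x = p y -> x = y.
  move=> Ax Ay pxy; apply/eqP; rewrite -subr_eq0; apply/eqP/Aker.
    by have := Alin (-1) _ _ Ay Ax; rewrite scaleN1r addrC.
  by rewrite linearB /= pxy subrr.
have slin : linear s.
  move=> a x y; apply: Auniq; first by case: (sP (a *: x + y)).
    by apply: Alin; [case: (sP x)|case: (sP y)].
  by rewrite linearP /= (sP _).2 (sP x).2 (sP y).2.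
pose sL : {linear V -> U} := HB.pack_for {linear V -> U} s
  (GRing.isLinear.Build K V U *:%R s slin).
by exists sL => y; case: (sP y).
Qed.

End LinearSection.

Record lie2_data (K : fieldType) := Lie2Data {
  deg0 : lmodType K;
  deg1 : lmodType K;
  diff : {linear deg1 -> deg0};
  br00 : deg0 -> deg0 -> deg0;
  br01 : deg0 -> deg1 -> deg1
}.

(* The mixed bracket in the other order, [a, x] = - [x, a]. *)
Definition br10 (K : fieldType) (L : lie2_data K) (a : deg1 L) (x : deg0 L) :
  deg1 L := - br01 x a.

(* The degree-0 bracket is defined on the exterior square, so it is required
   to be alternating; away from characteristic 2 this is skew-symmetry. *)
Record strict_lie2 (K : fieldType) := StrictLie2 {
  lie2_of :> lie2_data K;
  br00_bilinear : bilinear_for *:%R *:%R (@br00 K lie2_of);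
  br01_bilinear : bilinear_for *:%R *:%R (@br01 K lie2_of);
  br00_alt : forall x : deg0 lie2_of, br00 x x = 0;
  diff_br01 : forall (x : deg0 lie2_of) (a : deg1 lie2_of),
    diff lie2_of (br01 x a) = br00 x (diff lie2_of a);
  br01_diff : forall a b : deg1 lie2_of,
    br01 (diff lie2_of a) b = br10 a (diff lie2_of b);
  jacobi000 : forall x y z : deg0 lie2_of,
    br00 (br00 x y) z + br00 (br00 y z) x + br00 (br00 z x) y = 0;
  jacobi001 : forall (x y : deg0 lie2_of) (a : deg1 lie2_of),
    br01 (br00 x y) a + br10 (br01 y a) x + br10 (br10 a x) y = 0
}.

Record lie2_hom (K : fieldType) (L M : strict_lie2 K) := Lie2Hom {
  hom0 : {linear deg0 L -> deg0 M};
  hom1 : {linear deg1 L -> deg1 M};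
  hom_diff : forall a, diff M (hom1 a) = hom0 (diff L a);
  hom_br00 : forall x y, hom0 (br00 x y) = br00 (hom0 x) (hom0 y);
  hom_br01 : forall x a, hom1 (br01 x a) = br01 (hom0 x) (hom1 a)
}.

Section Lie2Theory.
Variables (K : fieldType) (L : strict_lie2 K).
Implicit Types (x y z : deg0 L) (a b : deg1 L).

Lemma br00Pl k x y z : br00 (k *: x + y) z = k *: br00 x z + br00 y z.
Proof. exact: (br00_bilinear L).1. Qed.
Lemma br00Pr k x y z : br00 z (k *: x + y) = k *: br00 z x + br00 z y.
Proof. exact: (br00_bilinear L).2. Qed.
Lemma br01Pl k x y a : br01 (k *: x + y) a = k *: br01 x a + br01 y a.
Proof. exact: (br01_bilinear L).1. Qed.
Lemma br01Pr k x a b : br01 x (k *: a + b) = k *: br01 x a + br01 x b.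
Proof. exact: (br01_bilinear L).2. Qed.

Lemma br00Dl x y z : br00 (x + y) z = br00 x z + br00 y z.
Proof. by rewrite -[x]scale1r br00Pl !scale1r. Qed.
Lemma br00Dr x y z : br00 z (x + y) = br00 z x + br00 z y.
Proof. by rewrite -[x]scale1r br00Pr !scale1r. Qed.
Lemma br01Dl x y a : br01 (x + y) a = br01 x a + br01 y a.
Proof. by rewrite -[x]scale1r br01Pl !scale1r. Qed.
Lemma br01Dr x a b : br01 x (a + b) = br01 x a + br01 x b.
Proof. by rewrite -[a]scale1r br01Pr !scale1r. Qed.

Lemma br00Bl x y z : br00 (x - y) z = br00 x z - br00 y z.
Proof. by rewrite addrC -scaleN1r br00Pl scaleN1r addrC. Qed.
Lemma br00Br x y z : br00 z (x - y) = br00 z x - br00 z y.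
Proof. by rewrite addrC -scaleN1r br00Pr scaleN1r addrC. Qed.
Lemma br01Bl x y a : br01 (x - y) a = br01 x a - br01 y a.
Proof. by rewrite addrC -scaleN1r br01Pl scaleN1r addrC. Qed.
Lemma br01Br x a b : br01 x (a - b) = br01 x a - br01 x b.
Proof. by rewrite addrC -scaleN1r br01Pr scaleN1r addrC. Qed.

Lemma br00_0l z : br00 0 z = 0.
Proof. by rewrite -{1}(subrr 0) br00Bl subrr. Qed.
Lemma br00_0r z : br00 z 0 = 0.
Proof. by rewrite -{1}(subrr 0) br00Br subrr. Qed.
Lemma br01_0l a : br01 (0 : deg0 L) a = 0.
Proof. by rewrite -{1}(subrr 0) br01Bl subrr. Qed.
Lemma br01_0r x : br01 x (0 : deg1 L) = 0.
Proof. by rewrite -{1}(subrr 0) br01Br subrr. Qed.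

Lemma br00Nr x y : br00 x (- y) = - br00 x y.
Proof. by rewrite -sub0r br00Br br00_0r sub0r. Qed.
Lemma br01Nr x a : br01 x (- a) = - br01 x a.
Proof. by rewrite -sub0r br01Br br01_0r sub0r. Qed.

Lemma br00_skew x y : br00 x y = - br00 y x.
Proof.
apply/eqP; rewrite -addr_eq0; apply/eqP.
by have := br00_alt (x + y); rewrite br00Dl !br00Dr !br00_alt add0r addr0.
Qed.

Lemma br00_Leibniz x y z :
  br00 x (br00 y z) = br00 (br00 x y) z + br00 y (br00 x z).
Proof.
have := jacobi000 x y z.
rewrite [br00 (br00 y z) x]br00_skew [br00 (br00 z x) y]br00_skew.
rewrite (br00_skew z x) br00Nr opprK addrAC => /eqP.
by rewrite subr_eq0 => /eqP ->.
Qed.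

Lemma br01_Leibniz x y a :
  br01 x (br01 y a) = br01 (br00 x y) a + br01 y (br01 x a).
Proof.
have := jacobi001 x y a.
rewrite /br10 br01Nr opprK addrAC => /eqP.
by rewrite subr_eq0 => /eqP ->.
Qed.

End Lie2Theory.

Record lie2_ideal (K : fieldType) (L : strict_lie2 K) := Lie2Ideal {
  ideal0 : {pred deg0 L};
  ideal1 : {pred deg1 L};
  ideal0_submod : GRing.submod_closed ideal0;
  ideal1_submod : GRing.submod_closed ideal1;
  ideal_diff : forall a, a \in ideal1 -> diff L a \in ideal0;
  ideal_br00 : forall x y, y \in ideal0 -> br00 x y \in ideal0;
  ideal_br01 : forall x a, a \in ideal1 -> br01 x a \in ideal1;
  ideal_br10 : forall a x, x \in ideal0 -> br10 a x \in ideal1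
}.

Section Quotient.
Variables (K : fieldType) (L : strict_lie2 K) (I : lie2_ideal L).

Let I0 := ideal0_submod I.
Let I1 := ideal1_submod I.

Definition quot_diff_fun (p : lquot I1) : lquot I0 :=
  lpi I0 (diff L (lrepr p)).
Definition quot_br00 (p q : lquot I0) : lquot I0 :=
  lpi I0 (br00 (lrepr p) (lrepr q)).
Definition quot_br01 (p : lquot I0) (q : lquot I1) : lquot I1 :=
  lpi I1 (br01 (lrepr p) (lrepr q)).

Lemma quot_diffE a : quot_diff_fun (lpi I1 a) = lpi I0 (diff L a).
Proof. by apply: lpi_eqP; rewrite -linearB; apply/ideal_diff/lreprP. Qed.

Lemma quot_br00E x y : quot_br00 (lpi I0 x) (lpi I0 y) = lpi I0 (br00 x y).
Proof.
set x' := lrepr (lpi I0 x); set y' := lrepr (lpi I0 y).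
have eqy : lpi I0 (br00 x' y') = lpi I0 (br00 x' y).
  by apply: lpi_eqP; rewrite -br00Br; apply/ideal_br00/lreprP.
have eqx : lpi I0 (br00 y x') = lpi I0 (br00 y x).
  by apply: lpi_eqP; rewrite -br00Br; apply/ideal_br00/lreprP.
rewrite [LHS]eqy (br00_skew x' y) (br00_skew x y).
by rewrite !lpiN eqx.
Qed.

Lemma quot_br01E x a : quot_br01 (lpi I0 x) (lpi I1 a) = lpi I1 (br01 x a).
Proof.
set x' := lrepr (lpi I0 x); set a' := lrepr (lpi I1 a).
have eqa : lpi I1 (br01 x' a') = lpi I1 (br01 x' a).
  by apply: lpi_eqP; rewrite -br01Br; apply/ideal_br01/lreprP.
rewrite [LHS]eqa; apply: lpi_eqP; rewrite -br01Bl.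
have -> : br01 (x' - x) a = (-1) *: br10 a (x' - x).
  by rewrite scaleN1r /br10 opprK.
by apply: (submodZ I1); apply/ideal_br10/lreprP.
Qed.

Lemma quot_diff_linear : linear quot_diff_fun.
Proof.
move=> k p q; rewrite -[p]lreprK -[q]lreprK -linearP !quot_diffE.
by rewrite !linearP.
Qed.

HB.instance Definition _ := GRing.isLinear.Build K (lquot I1) (lquot I0)
  *:%R quot_diff_fun quot_diff_linear.

Definition quot_data : lie2_data K :=
  @Lie2Data K (lquot I0) (lquot I1) quot_diff_fun quot_br00 quot_br01.

Lemma quot_br00_bilinear : bilinear_for *:%R *:%R (@br00 K quot_data).
Proof.
split=> [u k p q|u k p q] /=; rewrite -[p]lreprK -[q]lreprK -[u]lreprK.
  by rewrite -linearP !quot_br00E br00Pl linearP.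
by rewrite -linearP !quot_br00E br00Pr linearP.
Qed.

Lemma quot_br01_bilinear : bilinear_for *:%R *:%R (@br01 K quot_data).
Proof.
split=> [u k p q|u k p q] /=; rewrite -[p]lreprK -[q]lreprK -[u]lreprK.
  by rewrite -linearP !quot_br01E br01Pl linearP.
by rewrite -linearP !quot_br01E br01Pr linearP.
Qed.

Lemma quot_br00_alt (p : deg0 quot_data) : br00 p p = 0.
Proof. by rewrite -[p]lreprK /= quot_br00E br00_alt linear0. Qed.

Lemma quot_diff_br01 (p : deg0 quot_data) (q : deg1 quot_data) :
  diff quot_data (br01 p q) = br00 p (diff quot_data q).
Proof.
rewrite -[p]lreprK -[q]lreprK /= quot_br01E !quot_diffE quot_br00E.
by rewrite diff_br01.
Qed.

Lemma quot_br01_diff (p q : deg1 quot_data) :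
  br01 (diff quot_data p) q = br10 p (diff quot_data q).
Proof.
rewrite -[p]lreprK -[q]lreprK /br10 /= !quot_diffE !quot_br01E.
by rewrite br01_diff linearN.
Qed.

Lemma quot_jacobi000 (p q r : deg0 quot_data) :
  br00 (br00 p q) r + br00 (br00 q r) p + br00 (br00 r p) q = 0.
Proof.
rewrite -[p]lreprK -[q]lreprK -[r]lreprK /= !quot_br00E -!linearD.
by rewrite jacobi000 linear0.
Qed.

Lemma quot_jacobi001 (p q : deg0 quot_data) (r : deg1 quot_data) :
  br01 (br00 p q) r + br10 (br01 q r) p + br10 (br10 r p) q = 0.
Proof.
have br10E a x : @br10 K quot_data (lpi I1 a) (lpi I0 x) = lpi I1 (br10 a x).
  by rewrite /br10 /= quot_br01E lpiN.
rewrite -[p]lreprK -[q]lreprK -[r]lreprK /= quot_br00E !quot_br01E !br10E.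
by rewrite -!lpiD jacobi001 linear0.
Qed.

Definition quot_lie2 : strict_lie2 K :=
  StrictLie2 quot_br00_bilinear quot_br01_bilinear quot_br00_alt
    quot_diff_br01 quot_br01_diff quot_jacobi000 quot_jacobi001.

Definition quot_proj : lie2_hom L quot_lie2 :=
  @Lie2Hom K L quot_lie2 (lpi I0) (lpi I1)
    quot_diffE (fun x y => esym (quot_br00E x y))
    (fun x a => esym (quot_br01E x a)).

End Quotient.

Section Derivations.
Variables (K : fieldType) (h : strict_lie2 K).

Definition is_sder0 (X : (deg0 h -> deg0 h) * (deg1 h -> deg1 h)) : Prop :=
  [/\ linear X.1, linear X.2,
      forall m, X.1 (diff h m) = diff h (X.2 m),
      forall u v, X.1 (br00 u v) = br00 (X.1 u) v + br00 u (X.1 v)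
    & forall u m, X.2 (br01 u m) = br01 (X.1 u) m + br01 u (X.2 m)].

Definition is_sder1 (T : deg0 h -> deg1 h) : Prop :=
  linear T /\ forall u v, T (br00 u v) = br10 (T u) v + br01 u (T v).

Definition sder0_pred X : bool := `[< is_sder0 X >].
Definition sder1_pred T : bool := `[< is_sder1 T >].

Lemma sder0_submod : GRing.submod_closed sder0_pred.
Proof.
split.
  apply/asboolP; split => /=.
  - by move=> k u v; rewrite /= scaler0 addr0.
  - by move=> k u v; rewrite /= scaler0 addr0.
  - by move=> m; rewrite linear0.
  - move=> u v; apply/esym; rewrite -[RHS]addr0.
    by congr (_ + _); [exact: br00_0l | exact: br00_0r].
  - move=> u m; apply/esym; rewrite -[RHS]addr0.
    by congr (_ + _); [exact: br01_0l | exact: br01_0r].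
move=> k X Y /asboolP[X0l X1l Xd X0b X1b] /asboolP[Y0l Y1l Yd Y0b Y1b].
have E0 u : (k *: X + Y).1 u = k *: X.1 u + Y.1 u by [].
have E1 m : (k *: X + Y).2 m = k *: X.2 m + Y.2 m by [].
apply/asboolP; split.
- move=> c u v; rewrite !E0 X0l Y0l !scalerDr !scalerA addrACA [k * c]mulrC.
  by [].
- move=> c u v; rewrite !E1 X1l Y1l !scalerDr !scalerA addrACA [k * c]mulrC.
  by [].
- by move=> m; rewrite E0 E1 linearP Xd Yd.
- by move=> u v; rewrite !E0 X0b Y0b br00Pl br00Pr scalerDr addrACA.
- by move=> u m; rewrite !E0 !E1 X1b Y1b br01Pl br01Pr scalerDr addrACA.
Qed.

Lemma sder1_submod : GRing.submod_closed sder1_pred.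
Proof.
split.
  apply/asboolP; split; first by move=> k u v; rewrite /= scaler0 addr0.
  move=> u v; apply/esym; rewrite -[RHS]addr0; congr (_ + _).
    by rewrite /br10 br01_0r oppr0.
  exact: br01_0r.
move=> k S T /asboolP[Sl Sb] /asboolP[Tl Tb].
have E u : (k *: S + T) u = k *: S u + T u by [].
apply/asboolP; split.
  by move=> c u v; rewrite !E Sl Tl !scalerDr !scalerA addrACA [k * c]mulrC.
move=> u v; rewrite !E Sb Tb /br10 !br01Pr opprD -scalerN scalerDr addrACA.
by [].
Qed.

HB.instance Definition _ := GRing.isSubmodClosed.Build K
  ((deg0 h -> deg0 h) * (deg1 h -> deg1 h))%type sder0_pred
  (GRing.submod_closed_semi sder0_submod).
HB.instance Definition _ := GRing.isSubmodClosed.Build K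
  (deg0 h -> deg1 h) sder1_pred (GRing.submod_closed_semi sder1_submod).

Record sder0 := SDer0 {
  sder0_val :> (deg0 h -> deg0 h) * (deg1 h -> deg1 h);
  _ : sder0_val \in sder0_pred
}.
HB.instance Definition _ := [isSub for sder0_val].
HB.instance Definition _ := [Choice of sder0 by <:].
HB.instance Definition _ := [SubChoice_isSubLmodule of sder0 by <:].

Record sder1 := SDer1 {
  sder1_val :> deg0 h -> deg1 h;
  _ : sder1_val \in sder1_pred
}.
HB.instance Definition _ := [isSub for sder1_val].
HB.instance Definition _ := [Choice of sder1 by <:].
HB.instance Definition _ := [SubChoice_isSubLmodule of sder1 by <:].

End Derivations.

Lemma zmod_Leibniz (V : zmodType) (a b c d e f : V) :
  (a + b + (c + d)) - (e + c + (b + f)) = (a - e) + (d - f).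
Proof.
rewrite [X in X - _](AC (2*2) ((1*4)*(2*3))) /=.
rewrite [X in _ - X](AC (2*2) ((3*2)*(1*4))) /=.
rewrite addrKA opprD addrACA.
by [].
Qed.
Lemma zmod_sub4 (V : zmodType) (a b c d : V) :
  a - b - (c - d) = (a + d) - (b + c).
Proof. by rewrite opprB addrACA -opprD. Qed.

Lemma zmod_cycle (V : zmodType) (a b c : V) : (a - b) + (c - a) + (b - c) = 0.
Proof. by rewrite [a - b + _]addrC subrKA subrKA subrr. Qed.

Lemma zmod_Jacobi000 (V : zmodType) (a b c d e f : V) :
  (a - b - (c - d)) + (e - d - (a - f)) + (c - f - (e - b)) = 0.
Proof.
rewrite !zmod_sub4 [d + a]addrC [c + b]addrC [f + e]addrC.
exact: zmod_cycle.
Qed.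

Lemma zmod_Jacobi001 (V : zmodType) (a b c d e f : V) :
  (a - b - (c - d)) + - ((a - e) - (f - d)) + - (- (b - f) - - (e - c)) = 0.
Proof.
rewrite [- (a - e - _)]opprB opprD !opprK.
rewrite !zmod_sub4 [d + a]addrC [f + e]addrC.
exact: zmod_cycle.
Qed.

Lemma linear_funB (K : fieldType) (U V : lmodType K) (f : U -> V) :
  linear f -> forall x y, f (x - y) = f x - f y.
Proof. by move=> fl x y; rewrite addrC -scaleN1r fl scaleN1r addrC. Qed.

Lemma linear_funD (K : fieldType) (U V : lmodType K) (f : U -> V) :
  linear f -> forall x y, f (x + y) = f x + f y.
Proof. by move=> fl x y; rewrite -[x]scale1r fl !scale1r. Qed.

Lemma linear_funN (K : fieldType) (U V : lmodType K) (f : U -> V) :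
  linear f -> forall x, f (- x) = - f x.
Proof.
move=> fl x; have f0 : f 0 = 0.
  by rewrite -[X in f X](subrr 0) (linear_funB fl) subrr.
by rewrite -[- x]sub0r (linear_funB fl) f0 sub0r.
Qed.

Section SDer.
Variables (K : fieldType) (h : strict_lie2 K).
Implicit Types (X Y Z : sder0 h) (S T : sder1 h).

Lemma sder0P X : is_sder0 X.
Proof. by case: X => X hX; exact/asboolP. Qed.

Lemma sder1P T : is_sder1 T.
Proof. by case: T => T hT; exact/asboolP. Qed.

Lemma sder0_eq X Y : X.1 =1 Y.1 -> X.2 =1 Y.2 -> X = Y.
Proof.
move=> /funext e0 /funext e1; apply: val_inj => /=.
by move: e0 e1; case: (sder0_val X) => ? ?; case: (sder0_val Y) => ? ? /= -> ->.
Qed.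

Lemma sder1_eq S T : S =1 T -> S = T.
Proof. by move=> /funext e; apply: val_inj. Qed.

Lemma sder_diff_subproof T :
  ((fun u => diff h (T u), fun m => T (diff h m)) : _ * _) \in @sder0_pred K h.
Proof.
have [Tl Tb] := sder1P T; apply/asboolP; split => //=.
- by move=> k u v; rewrite Tl linearP.
- by move=> k m n; rewrite linearP Tl.
- move=> u v; rewrite Tb linearD /br10 linearN /= !diff_br01.
  by rewrite -br00_skew.
- move=> u m; rewrite diff_br01 Tb; congr (_ + _).
  by rewrite -br01_diff.
Qed.

Definition sder_diff T : sder0 h := SDer0 (sder_diff_subproof T).

Lemma sder_br00_subproof X Y :
  ((fun u => X.1 (Y.1 u) - Y.1 (X.1 u), fun m => X.2 (Y.2 m) - Y.2 (X.2 m))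
    : _ * _) \in @sder0_pred K h.
Proof.
have [X0l X1l Xd X0b X1b] := sder0P X; have [Y0l Y1l Yd Y0b Y1b] := sder0P Y.
apply/asboolP; split => /=.
- move=> k u v; rewrite !(X0l, Y0l) scalerBr opprD addrACA.
  by [].
- by move=> k m n; rewrite !(X1l, Y1l) scalerBr opprD addrACA.
- by move=> m; rewrite Yd Xd [X.1 _]Xd Yd linearB.
- move=> u v; rewrite X0b Y0b (linear_funD X0l) (linear_funD Y0l) !X0b !Y0b.
  by rewrite zmod_Leibniz br00Bl br00Br.
- move=> u m; rewrite X1b Y1b (linear_funD X1l) (linear_funD Y1l) !X1b !Y1b.
  by rewrite zmod_Leibniz br01Bl br01Br.
Qed.

Definition sder_br00 X Y : sder0 h := SDer0 (sder_br00_subproof X Y).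

Lemma sder_br01_subproof X T :
  (fun u => X.2 (T u) - T (X.1 u)) \in @sder1_pred K h.
Proof.
have [X0l X1l Xd X0b X1b] := sder0P X; have [Tl Tb] := sder1P T.
apply/asboolP; split => /=.
  by move=> k u v; rewrite !(X0l, X1l, Tl) scalerBr opprD addrACA.
move=> u v; rewrite X0b Tb (linear_funD X1l) (linear_funD Tl) !Tb /br10.
rewrite (linear_funN X1l) !X1b (addrC (br01 (X.1 v) (T u))) opprD.
by rewrite zmod_Leibniz !br01Br opprD.
Qed.

Definition sder_br01 X T : sder1 h := SDer1 (sder_br01_subproof X T).

Lemma sder_diff_linear : linear sder_diff.
Proof.
move=> k S T; apply: sder0_eq => [u|m] //=.
exact: (linearP (diff h)).
Qed.

HB.instance Definition _ := GRing.isLinear.Build K (sder1 h) (sder0 h)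
  *:%R sder_diff sder_diff_linear.

Definition sder_data : lie2_data K :=
  @Lie2Data K (sder0 h) (sder1 h) sder_diff sder_br00 sder_br01.

Lemma sder_br00_bilinear : bilinear_for *:%R *:%R (@br00 K sder_data).
Proof.
split=> [Z k X Y|Z k X Y]; have [Z0l Z1l _ _ _] := sder0P Z.
  apply: sder0_eq => [u|m] /=.
    rewrite [LHS](_ : _ = (k *: X.1 (Z.1 u) + Y.1 (Z.1 u)) -
      Z.1 (k *: X.1 u + Y.1 u)) // Z0l opprD addrACA -scalerBr.
    by [].
  rewrite [LHS](_ : _ = (k *: X.2 (Z.2 m) + Y.2 (Z.2 m)) -
    Z.2 (k *: X.2 m + Y.2 m)) // Z1l opprD addrACA -scalerBr.
  by [].
apply: sder0_eq => [u|m] /=.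
  rewrite [LHS](_ : _ = Z.1 (k *: X.1 u + Y.1 u) -
    (k *: X.1 (Z.1 u) + Y.1 (Z.1 u))) // Z0l opprD addrACA -scalerBr.
  by [].
rewrite [LHS](_ : _ = Z.2 (k *: X.2 m + Y.2 m) -
  (k *: X.2 (Z.2 m) + Y.2 (Z.2 m))) // Z1l opprD addrACA -scalerBr.
by [].
Qed.

Lemma sder_br01_bilinear : bilinear_for *:%R *:%R (@br01 K sder_data).
Proof.
split=> [T k X Y|X k S T].
  have [Tl _] := sder1P T; apply: sder1_eq => u /=.
  rewrite [LHS](_ : _ = (k *: X.2 (T u) + Y.2 (T u)) -
    T (k *: X.1 u + Y.1 u)) // Tl opprD addrACA -scalerBr.
  by [].
have [_ X1l _ _ _] := sder0P X; apply: sder1_eq => u /=.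
rewrite [LHS](_ : _ = X.2 (k *: S u + T u) -
  (k *: S (X.1 u) + T (X.1 u))) // X1l opprD addrACA -scalerBr.
by [].
Qed.

Lemma sder_br00_alt (X : deg0 sder_data) : br00 X X = 0.
Proof. by apply: sder0_eq => [u|m] /=; rewrite subrr. Qed.

Lemma sder_diff_br01 (X : deg0 sder_data) (T : deg1 sder_data) :
  diff sder_data (br01 X T) = br00 X (diff sder_data T).
Proof.
have [_ _ Xd _ _] := sder0P X.
apply: sder0_eq => [u|m] /=; first by rewrite linearB /= -Xd.
by rewrite Xd.
Qed.

Lemma sder_br01_diff (S T : deg1 sder_data) :
  br01 (diff sder_data S) T = br10 S (diff sder_data T).
Proof.
apply: sder1_eq => u.
rewrite [RHS](_ : _ = - (T (diff h (S u)) - S (diff h (T u)))) //.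
by rewrite opprB.
Qed.

Lemma sder_jacobi000 (X Y Z : deg0 sder_data) :
  br00 (br00 X Y) Z + br00 (br00 Y Z) X + br00 (br00 Z X) Y = 0.
Proof.
have [X0l X1l _ _ _] := sder0P X; have [Y0l Y1l _ _ _] := sder0P Y.
have [Z0l Z1l _ _ _] := sder0P Z.
apply: sder0_eq => [u|m].
  rewrite [LHS](_ : _ =
    (X.1 (Y.1 (Z.1 u)) - Y.1 (X.1 (Z.1 u)) - Z.1 (X.1 (Y.1 u) - Y.1 (X.1 u))) +
    (Y.1 (Z.1 (X.1 u)) - Z.1 (Y.1 (X.1 u)) - X.1 (Y.1 (Z.1 u) - Z.1 (Y.1 u))) +
    (Z.1 (X.1 (Y.1 u)) - X.1 (Z.1 (Y.1 u)) - Y.1 (Z.1 (X.1 u) - X.1 (Z.1 u))))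
    //.
  rewrite (linear_funB X0l) (linear_funB Y0l) (linear_funB Z0l).
  exact: zmod_Jacobi000.
rewrite [LHS](_ : _ =
  (X.2 (Y.2 (Z.2 m)) - Y.2 (X.2 (Z.2 m)) - Z.2 (X.2 (Y.2 m) - Y.2 (X.2 m))) +
  (Y.2 (Z.2 (X.2 m)) - Z.2 (Y.2 (X.2 m)) - X.2 (Y.2 (Z.2 m) - Z.2 (Y.2 m))) +
  (Z.2 (X.2 (Y.2 m)) - X.2 (Z.2 (Y.2 m)) - Y.2 (Z.2 (X.2 m) - X.2 (Z.2 m))))
  //.
rewrite (linear_funB X1l) (linear_funB Y1l) (linear_funB Z1l).
exact: zmod_Jacobi000.
Qed.

Lemma sder_jacobi001 (X Y : deg0 sder_data) (T : deg1 sder_data) :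
  br01 (br00 X Y) T + br10 (br01 Y T) X + br10 (br10 T X) Y = 0.
Proof.
have [X0l X1l _ _ _] := sder0P X; have [Y0l Y1l _ _ _] := sder0P Y.
have [Tl _] := sder1P T.
apply: sder1_eq => u.
rewrite [LHS](_ : _ =
  (X.2 (Y.2 (T u)) - Y.2 (X.2 (T u)) - T (X.1 (Y.1 u) - Y.1 (X.1 u))) +
  - (X.2 (Y.2 (T u) - T (Y.1 u)) - (Y.2 (T (X.1 u)) - T (Y.1 (X.1 u)))) +
  - (Y.2 (- (X.2 (T u) - T (X.1 u))) - - (X.2 (T (Y.1 u)) - T (X.1 (Y.1 u)))))
  //.
rewrite (linear_funN Y1l) (linear_funB X1l) (linear_funB Y1l) (linear_funB Tl).
exact: zmod_Jacobi001.
Qed.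

Definition SDer : strict_lie2 K :=
  StrictLie2 sder_br00_bilinear sder_br01_bilinear sder_br00_alt
    sder_diff_br01 sder_br01_diff sder_jacobi000 sder_jacobi001.

End SDer.

Section Adjoint.
Variables (K : fieldType) (h : strict_lie2 K).

Lemma ad0_subproof (u : deg0 h) :
  ((fun v => br00 u v, fun m => br01 u m) : _ * _) \in @sder0_pred K h.
Proof.
apply/asboolP; split => /=.
- by move=> k v w; rewrite br00Pr.
- by move=> k m n; rewrite br01Pr.
- by move=> m; rewrite diff_br01.
- by move=> v w; exact: br00_Leibniz.
- by move=> v m; exact: br01_Leibniz.
Qed.

Definition ad0 (u : deg0 h) : deg0 (SDer h) := SDer0 (ad0_subproof u).

Lemma ad1_subproof (m : deg1 h) :
  (fun u => br10 m u) \in @sder1_pred K h.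
Proof.
apply/asboolP; split.
  by move=> k u v; rewrite /br10 br01Pl opprD scalerN.
move=> u v; rewrite /br10 !br01Nr opprK.
by rewrite (br01_Leibniz u v m) opprD addrCA subrr addr0.
Qed.

Definition ad1 (m : deg1 h) : deg1 (SDer h) := SDer1 (ad1_subproof m).

Lemma ad0_linear : linear ad0.
Proof.
by move=> k u v; apply: sder0_eq => [w|m] /=; [exact: br00Pl|exact: br01Pl].
Qed.

Lemma ad1_linear : linear ad1.
Proof.
move=> k m n; apply: sder1_eq => u.
rewrite [RHS](_ : _ = k *: br10 m u + br10 n u) //.
by rewrite [LHS](_ : _ = - br01 u (k *: m + n)) // br01Pr opprD scalerN.
Qed.

HB.instance Definition _ :=
  GRing.isLinear.Build K (deg0 h) (deg0 (SDer h)) *:%R ad0 ad0_linear.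
HB.instance Definition _ :=
  GRing.isLinear.Build K (deg1 h) (deg1 (SDer h)) *:%R ad1 ad1_linear.

Lemma ad_diff m : diff (SDer h) (ad1 m) = ad0 (diff h m).
Proof.
apply: sder0_eq => [u|n] /=.
  by rewrite /br10 linearN /= diff_br01 -br00_skew.
by rewrite br01_diff.
Qed.

Lemma br_ad0 (X : deg0 (SDer h)) u : br00 X (ad0 u) = ad0 (X.1 u).
Proof.
have [X0l X1l _ X0b X1b] := sder0P X.
by apply: sder0_eq => [v|m] /=; rewrite ?X0b ?X1b addrK.
Qed.

Lemma br_ad1 (X : deg0 (SDer h)) m : br01 X (ad1 m) = ad1 (X.2 m).
Proof.
have [X0l X1l _ X0b X1b] := sder0P X.
apply: sder1_eq => v.
rewrite [LHS](_ : _ = X.2 (- br01 v m) - - br01 (X.1 v) m) // opprK.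
by rewrite (linear_funN X1l) X1b opprD addrAC addNr add0r.
Qed.

Lemma br10_ad0 (T : deg1 (SDer h)) u : br10 T (ad0 u) = ad1 (T u).
Proof.
have [Tl Tb] := sder1P T.
apply: sder1_eq => v.
rewrite [LHS](_ : _ = - (br01 u (T v) - T (br00 u v))) // opprB Tb.
by rewrite addrK.
Qed.

Lemma ad_br00 u v : ad0 (br00 u v) = br00 (ad0 u) (ad0 v).
Proof. by rewrite br_ad0. Qed.

Lemma ad_br01 u m : ad1 (br01 u m) = br01 (ad0 u) (ad1 m).
Proof. by rewrite br_ad1. Qed.

Definition adjoint : lie2_hom h (SDer h) :=
  @Lie2Hom K h (SDer h) ad0 ad1 ad_diff ad_br00 ad_br01.

Definition center0 : set (deg0 h) := [set u | hom0 adjoint u = 0].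
Definition center1 : set (deg1 h) := [set m | hom1 adjoint m = 0].

Definition trivial_center : Prop := center1 = [set 0] /\ center0 = [set 0].

Definition inner0 : {pred deg0 (SDer h)} :=
  fun X => `[< exists u, hom0 adjoint u = X >].
Definition inner1 : {pred deg1 (SDer h)} :=
  fun T => `[< exists m, hom1 adjoint m = T >].

Lemma inner0_submod : GRing.submod_closed inner0.
Proof.
split; first by apply/asboolP; exists 0; rewrite linear0.
move=> k _ _ /asboolP[u <-] /asboolP[v <-]; apply/asboolP.
by exists (k *: u + v); rewrite linearP.
Qed.

Lemma inner1_submod : GRing.submod_closed inner1.
Proof.
split; first by apply/asboolP; exists 0; rewrite linear0.
move=> k _ _ /asboolP[m <-] /asboolP[n <-]; apply/asboolP.
by exists (k *: m + n); rewrite linearP.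
Qed.

Lemma inner_diff T : T \in inner1 -> diff (SDer h) T \in inner0.
Proof.
by move=> /asboolP[m <-]; apply/asboolP; exists (diff h m); rewrite hom_diff.
Qed.

Lemma inner_br00 X Y : Y \in inner0 -> br00 X Y \in inner0.
Proof.
by move=> /asboolP[u <-]; apply/asboolP; exists (X.1 u); rewrite /= -br_ad0.
Qed.

Lemma inner_br01 (X : deg0 (SDer h)) T : T \in inner1 -> br01 X T \in inner1.
Proof.
by move=> /asboolP[m <-]; apply/asboolP; exists (X.2 m); rewrite /= -br_ad1.
Qed.

Lemma inner_br10 (T : deg1 (SDer h)) X : X \in inner0 -> br10 T X \in inner1.
Proof.
by move=> /asboolP[u <-]; apply/asboolP; exists (T u); rewrite /= -br10_ad0.
Qed.

Definition SInn : lie2_ideal (SDer h) :=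
  Lie2Ideal inner0_submod inner1_submod inner_diff inner_br00 inner_br01
    inner_br10.

Definition SOut : strict_lie2 K := quot_lie2 SInn.

Definition SOut_proj : lie2_hom (SDer h) SOut := quot_proj SInn.

End Adjoint.

Record extension (K : fieldType) (g h : strict_lie2 K) := Extension {
  total : strict_lie2 K;
  incl : lie2_hom h total;
  proj : lie2_hom total g;
  incl0_inj : injective (hom0 incl);
  incl1_inj : injective (hom1 incl);
  exact0 : range (hom0 incl) = [set y | hom0 proj y = 0];
  exact1 : range (hom1 incl) = [set b | hom1 proj b = 0];
  proj0_surj : forall x, exists y, hom0 proj y = x;
  proj1_surj : forall a, exists b, hom1 proj b = a
}.

Definition ext_iso (K : fieldType) (g h : strict_lie2 K)
    (E E' : extension g h) : Prop :=
  exists F : lie2_hom (total E) (total E'),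
    [/\ forall u, hom0 F (hom0 (incl E) u) = hom0 (incl E') u,
        forall m, hom1 F (hom1 (incl E) m) = hom1 (incl E') m,
        forall y, hom0 (proj E') (hom0 F y) = hom0 (proj E) y
      & forall b, hom1 (proj E') (hom1 F b) = hom1 (proj E) b].

(* [classical_sets.set] cannot be used here, for universe reasons: extensions
   form a large type. *)
Definition iso_class (K : fieldType) (g h : strict_lie2 K) :=
  {C : extension g h -> Prop | exists E, C = ext_iso E}.

Definition iso_class_of (K : fieldType) (g h : strict_lie2 K)
    (E : extension g h) : iso_class g h :=
  exist _ (ext_iso E) (ex_intro _ E erefl).

Section Induced.
Variables (K : fieldType) (g h : strict_lie2 K) (E : extension g h).

Let p0 := hom0 (proj E).
Let p1 := hom1 (proj E).
Let i0 := hom0 (incl E).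
Let i1 := hom1 (incl E).

(* The inverses of [h_k -> i(h_k)]; they identify [h] with [i(h)]. *)
Definition uninc0 (y : deg0 (total E)) : deg0 h := xget 0 [set u | i0 u = y].
Definition uninc1 (b : deg1 (total E)) : deg1 h := xget 0 [set m | i1 m = b].

Lemma projK0 u : p0 (i0 u) = 0.
Proof.
by have : range i0 (i0 u) by [exists u]; rewrite (exact0 E).
Qed.

Lemma projK1 m : p1 (i1 m) = 0.
Proof.
by have : range i1 (i1 m) by [exists m]; rewrite (exact1 E).
Qed.

Lemma uninc0K y : p0 y = 0 -> i0 (uninc0 y) = y.
Proof.
move=> py0; have : range i0 y by rewrite (exact0 E).
by move=> [u _ iu]; apply: (@xgetI _ 0 [set u | i0 u = y] u).
Qed.

Lemma uninc1K b : p1 b = 0 -> i1 (uninc1 b) = b.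
Proof.
move=> pb0; have : range i1 b by rewrite (exact1 E).
by move=> [m _ im]; apply: (@xgetI _ 0 [set m | i1 m = b] m).
Qed.

Definition act00 (y : deg0 (total E)) (v : deg0 h) := uninc0 (br00 y (i0 v)).
Definition act01 (y : deg0 (total E)) (m : deg1 h) := uninc1 (br01 y (i1 m)).
Definition act10 (b : deg1 (total E)) (v : deg0 h) := uninc1 (br10 b (i0 v)).

Lemma act00K y v : i0 (act00 y v) = br00 y (i0 v).
Proof. by apply: uninc0K; rewrite /p0 hom_br00 projK0 br00_0r. Qed.

Lemma act01K y m : i1 (act01 y m) = br01 y (i1 m).
Proof. by apply: uninc1K; rewrite /p1 hom_br01 projK1 br01_0r. Qed.

Lemma act10K b v : i1 (act10 b v) = br10 b (i0 v).
Proof.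
by apply: uninc1K; rewrite /p1 /br10 linearN /= hom_br01 projK0 br01_0l oppr0.
Qed.

Lemma act0_subproof y :
  ((act00 y, act01 y) : _ * _) \in @sder0_pred K h.
Proof.
apply/asboolP; split => /=.
- move=> k u v; apply: (@incl0_inj _ _ _ E); rewrite linearP !act00K linearP.
  exact: br00Pr.
- move=> k m n; apply: (@incl1_inj _ _ _ E); rewrite linearP !act01K linearP.
  exact: br01Pr.
- move=> m; apply: (@incl0_inj _ _ _ E).
  by rewrite -hom_diff act00K act01K diff_br01 -hom_diff.
- move=> u v; apply: (@incl0_inj _ _ _ E).
  rewrite linearD /= !hom_br00 !act00K hom_br00; exact: br00_Leibniz.
- move=> u m; apply: (@incl1_inj _ _ _ E).
  rewrite linearD /= !hom_br01 !act01K act00K hom_br01; exact: br01_Leibniz.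
Qed.

Definition act0 y : deg0 (SDer h) := SDer0 (act0_subproof y).

Lemma act1_subproof b : act10 b \in @sder1_pred K h.
Proof.
apply/asboolP; split => /=.
  move=> k u v; apply: (@incl1_inj _ _ _ E); rewrite linearP !act10K linearP.
  by rewrite /br10 br01Pl opprD scalerN.
move=> u v; apply: (@incl1_inj _ _ _ E).
rewrite linearD /br10 linearN /= !hom_br01 !act10K hom_br00 /br10.
by rewrite !br01Nr opprK (br01_Leibniz (i0 u)) opprD addrCA subrr addr0.
Qed.

Definition act1 b : deg1 (SDer h) := SDer1 (act1_subproof b).

Lemma act0_linear : linear act0.
Proof.
move=> k y z; apply: sder0_eq => [v|m].
  apply: (@incl0_inj _ _ _ E).
  rewrite [in RHS](_ : _.1 v = k *: act00 y v + act00 z v) // linearP !act00K.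
  exact: br00Pl.
apply: (@incl1_inj _ _ _ E).
rewrite [in RHS](_ : _.2 m = k *: act01 y m + act01 z m) // linearP !act01K.
exact: br01Pl.
Qed.

Lemma act1_linear : linear act1.
Proof.
move=> k a b; apply: sder1_eq => v; apply: (@incl1_inj _ _ _ E).
rewrite [in RHS](_ : _ v = k *: act10 a v + act10 b v) // linearP !act10K.
by rewrite /br10 br01Pr opprD scalerN.
Qed.

HB.instance Definition _ := GRing.isLinear.Build K (deg0 (total E))
  (deg0 (SDer h)) *:%R act0 act0_linear.
HB.instance Definition _ := GRing.isLinear.Build K (deg1 (total E))
  (deg1 (SDer h)) *:%R act1 act1_linear.

Lemma act_diff b : diff (SDer h) (act1 b) = act0 (diff (total E) b).
Proof.
apply: sder0_eq => [v|m].
  apply: (@incl0_inj _ _ _ E); rewrite act00K -hom_diff act10K.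
  by rewrite /br10 linearN /= diff_br01 -br00_skew.
apply: (@incl1_inj _ _ _ E); rewrite act01K [LHS]act10K br01_diff.
by rewrite hom_diff.
Qed.

Lemma act_br00 y z : act0 (br00 y z) = br00 (act0 y) (act0 z).
Proof.
apply: sder0_eq => [v|m].
  apply: (@incl0_inj _ _ _ E); rewrite act00K.
  rewrite [in RHS](_ : _.1 v = act00 y (act00 z v) - act00 z (act00 y v)) //.
  by rewrite linearB /= !act00K br00_Leibniz addrK.
apply: (@incl1_inj _ _ _ E); rewrite act01K.
rewrite [in RHS](_ : _.2 m = act01 y (act01 z m) - act01 z (act01 y m)) //.
by rewrite linearB /= !act01K br01_Leibniz addrK.
Qed.

Lemma act_br01 y b : act1 (br01 y b) = br01 (act0 y) (act1 b).
Proof.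
apply: sder1_eq => v; apply: (@incl1_inj _ _ _ E); rewrite act10K.
rewrite [in RHS](_ : _ v = act01 y (act10 b v) - act10 b (act00 y v)) //.
rewrite linearB /= act01K !act10K act00K /br10 br01Nr (br01_Leibniz y).
by rewrite opprD opprK addrAC addNr add0r.
Qed.

Lemma act0_incl u : act0 (i0 u) = ad0 u.
Proof.
apply: sder0_eq => [v|m].
  by apply: (@incl0_inj _ _ _ E); rewrite act00K /= hom_br00.
by apply: (@incl1_inj _ _ _ E); rewrite act01K /= hom_br01.
Qed.

Lemma act1_incl m : act1 (i1 m) = ad1 m.
Proof.
apply: sder1_eq => v; apply: (@incl1_inj _ _ _ E).
by rewrite act10K /= /br10 linearN /= hom_br01.
Qed.

Lemma act0_proj y z : p0 y = p0 z ->
  hom0 (SOut_proj h) (act0 y) = hom0 (SOut_proj h) (act0 z).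
Proof.
move=> pyz; apply: lpi_eqP; rewrite -linearB /=; apply/asboolP.
exists (uninc0 (y - z)); apply: etrans (esym (act0_incl _)) _; rewrite uninc0K //.
by rewrite linearB /= pyz subrr.
Qed.

Lemma act1_proj a b : p1 a = p1 b ->
  hom1 (SOut_proj h) (act1 a) = hom1 (SOut_proj h) (act1 b).
Proof.
move=> pab; apply: lpi_eqP; rewrite -linearB /=; apply/asboolP.
exists (uninc1 (a - b)); apply: etrans (esym (act1_incl _)) _; rewrite uninc1K //.
by rewrite linearB /= pab subrr.
Qed.

Section WithSections.
Variables (s0 : {linear deg0 g -> deg0 (total E)})
  (s1 : {linear deg1 g -> deg1 (total E)}).
Hypotheses (s0K : cancel s0 p0) (s1K : cancel s1 p1).

Definition mu0 (x : deg0 g) : deg0 (SDer h) := act0 (s0 x).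
Definition mu1 (a : deg1 g) : deg1 (SDer h) := act1 (s1 a).

Definition mubar0 (x : deg0 g) : deg0 (SOut h) := hom0 (SOut_proj h) (mu0 x).
Definition mubar1 (a : deg1 g) : deg1 (SOut h) := hom1 (SOut_proj h) (mu1 a).

Lemma mubar0_linear : linear mubar0.
Proof. by move=> k x y; rewrite /mubar0 /mu0 !linearP. Qed.

Lemma mubar1_linear : linear mubar1.
Proof. by move=> k x y; rewrite /mubar1 /mu1 !linearP. Qed.

HB.instance Definition _ :=
  GRing.isLinear.Build K (deg0 g) (deg0 (SOut h)) *:%R mubar0 mubar0_linear.
HB.instance Definition _ :=
  GRing.isLinear.Build K (deg1 g) (deg1 (SOut h)) *:%R mubar1 mubar1_linear.

Lemma mubar_diff a : diff (SOut h) (mubar1 a) = mubar0 (diff g a).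
Proof.
rewrite /mubar1 /mu1 hom_diff act_diff; apply: act0_proj.
by rewrite s0K /p0 -hom_diff -/p1 s1K.
Qed.

Lemma mubar_br00 x y : mubar0 (br00 x y) = br00 (mubar0 x) (mubar0 y).
Proof.
rewrite /mubar0 /mu0 -hom_br00 -act_br00; apply: act0_proj.
by rewrite s0K /p0 hom_br00 -/p0 !s0K.
Qed.

Lemma mubar_br01 x a : mubar1 (br01 x a) = br01 (mubar0 x) (mubar1 a).
Proof.
rewrite /mubar0 /mubar1 /mu0 /mu1 -hom_br01 -act_br01; apply: act1_proj.
by rewrite s1K /p1 hom_br01 -/p1 -/p0 s0K s1K.
Qed.

Definition induced_by : lie2_hom g (SOut h) :=
  @Lie2Hom K g (SOut h) mubar0 mubar1 mubar_diff mubar_br00 mubar_br01.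

End WithSections.

(* By [induced_homE0] and [induced_homE1] the choice of sections is immaterial. *)
Definition section0 := sval (cid (linear_section_exists (@proj0_surj _ _ _ E))).
Definition section1 := sval (cid (linear_section_exists (@proj1_surj _ _ _ E))).

Lemma section0K : cancel section0 p0.
Proof. by rewrite /section0; case: (cid _). Qed.
Lemma section1K : cancel section1 p1.
Proof. by rewrite /section1; case: (cid _). Qed.

Definition induced_hom : lie2_hom g (SOut h) :=
  induced_by section0K section1K.

Lemma induced_homE0 (s0 : {linear deg0 g -> deg0 (total E)}) :
  cancel s0 p0 ->
  forall x, hom0 induced_hom x = hom0 (SOut_proj h) (act0 (s0 x)).
Proof. by move=> s0K x; apply: act0_proj; rewrite s0K section0K. Qed.

Lemma induced_homE1 (s1 : {linear deg1 g -> deg1 (total E)}) :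
  cancel s1 p1 ->
  forall a, hom1 induced_hom a = hom1 (SOut_proj h) (act1 (s1 a)).
Proof. by move=> s1K a; apply: act1_proj; rewrite s1K section1K. Qed.

End Induced.

(* Main.v *)
From HB Require Import structures.
From mathcomp Require Import all_boot all_algebra.
From mathcomp Require Import all_classical.
Require Import Defs.

(** When [Cen(h) = 0], the adjoint [h -> SDer(h)] is injective, so that
    [0 -> h -> SDer(h) -> SOut(h) -> 0] is itself an extension.  Pulling it back
    along [mubar : g -> SOut(h)] gives an extension inducing [mubar]; conversely
    any extension [E] maps to the pullback along its induced homomorphism by
    [y |-> (p y, [y, -])], and such a morphism of extensions is invertible. *)

Set Implicit Arguments.
Unset Strict Implicit.
Unset Printing Implicit Defensive.

Import GRing.Theory.
Local Open Scope ring_scope.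
Local Open Scope classical_set_scope.

(** * Strict homomorphisms: extensionality, composition and inverses *)

Section Homomorphisms.
Variable K : fieldType.

(** Besides the function, a linear map packs only proofs, which proof irrelevance identifies. *)
Lemma linear_ext (U V : lmodType K) (f g : {linear U -> V}) :
  f =1 g -> f = g.
Proof.
case: f g => f [[f1] [f2]] [g [[g1] [g2]]] /= /funext fg.
by subst g; do 2 f_equal; f_equal; exact: Prop_irrelevance.
Qed.

Lemma lie2_hom_ext (L M : strict_lie2 K) (f g : lie2_hom L M) :
  hom0 f =1 hom0 g -> hom1 f =1 hom1 g -> f = g.
Proof.
case: f g => f0 f1 a b c [g0 g1 a' b' c'] /= /linear_ext e0 /linear_ext e1.
by subst g0 g1; f_equal; exact: Prop_irrelevance.
Qed.

Definition lie2_id (L : strict_lie2 K) : lie2_hom L L :=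
  @Lie2Hom K L L idfun idfun (fun=> erefl) (fun _ _ => erefl)
    (fun _ _ => erefl).

Section Composition.
Variables (L M N : strict_lie2 K) (f : lie2_hom M N) (g : lie2_hom L M).

Lemma comp_diff a :
  diff N ((hom1 f \o hom1 g) a) = (hom0 f \o hom0 g) (diff L a).
Proof. by rewrite /= !hom_diff. Qed.

Lemma comp_br00 x y :
  (hom0 f \o hom0 g) (br00 x y) =
  br00 ((hom0 f \o hom0 g) x) ((hom0 f \o hom0 g) y).
Proof. by rewrite /= !hom_br00. Qed.

Lemma comp_br01 x a :
  (hom1 f \o hom1 g) (br01 x a) =
  br01 ((hom0 f \o hom0 g) x) ((hom1 f \o hom1 g) a).
Proof. by rewrite /= !hom_br01. Qed.

Definition lie2_comp : lie2_hom L N := Lie2Hom comp_diff comp_br00 comp_br01.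

End Composition.

Lemma can_linear (U V : lmodType K) (f : {linear U -> V}) (g : V -> U) :
  cancel g f -> injective f -> linear g.
Proof. by move=> gK finj k x y; apply: finj; rewrite linearP !gK. Qed.

(** Choice provides set-theoretic right inverses; linearity and compatibility with [diff] and the
    brackets are then checked after applying the injective maps [hom0 f] and [hom1 f]. *)
Lemma lie2_hom_inverse (L M : strict_lie2 K) (f : lie2_hom L M) :
  injective (hom0 f) -> injective (hom1 f) ->
  (forall y, exists x, hom0 f x = y) -> (forall b, exists a, hom1 f a = b) ->
  exists f' : lie2_hom M L,
    cancel (hom0 f') (hom0 f) /\ cancel (hom1 f') (hom1 f).
Proof.
move=> inj0 inj1 /choice[g0 g0K] /choice[g1 g1K].
pose G0 : {linear deg0 M -> deg0 L} := HB.pack_for {linear deg0 M -> deg0 L} g0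
  (GRing.isLinear.Build K _ _ *:%R g0 (can_linear g0K inj0)).
pose G1 : {linear deg1 M -> deg1 L} := HB.pack_for {linear deg1 M -> deg1 L} g1
  (GRing.isLinear.Build K _ _ *:%R g1 (can_linear g1K inj1)).
unshelve eexists (@Lie2Hom K M L G0 G1 _ _ _); last by [].
- by move=> a; apply: (inj0); rewrite -hom_diff /= g1K g0K.
- by move=> x y; apply: (inj0); rewrite hom_br00 /= !g0K.
- by move=> x a; apply: (inj1); rewrite hom_br01 /= g1K g0K g1K.
Qed.

End Homomorphisms.

(** * The pullback of strict Lie 2-algebras and its pairing map *)

Section Pullback.
Variables (K : fieldType) (L M N : strict_lie2 K).
Variables (f : lie2_hom L N) (p : lie2_hom M N).

Definition pull0_pred : {pred deg0 L * deg0 M} :=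
  fun z => hom0 f z.1 == hom0 p z.2.
Definition pull1_pred : {pred deg1 L * deg1 M} :=
  fun z => hom1 f z.1 == hom1 p z.2.

Lemma pull0_submod : GRing.submod_closed pull0_pred.
Proof.
split; first by rewrite /in_mem /= /pull0_pred !linear0.
move=> k y z; rewrite /in_mem /= /pull0_pred => /eqP yE /eqP zE.
by rewrite !linearP /= yE zE.
Qed.

Lemma pull1_submod : GRing.submod_closed pull1_pred.
Proof.
split; first by rewrite /in_mem /= /pull1_pred !linear0.
move=> k y z; rewrite /in_mem /= /pull1_pred => /eqP yE /eqP zE.
by rewrite !linearP /= yE zE.
Qed.

HB.instance Definition _ := GRing.isSubmodClosed.Build K
  (deg0 L * deg0 M)%type pull0_pred (GRing.submod_closed_semi pull0_submod).
HB.instance Definition _ := GRing.isSubmodClosed.Build K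
  (deg1 L * deg1 M)%type pull1_pred (GRing.submod_closed_semi pull1_submod).

Record pull0 := Pull0 {
  pull0_val :> deg0 L * deg0 M;
  _ : pull0_val \in pull0_pred
}.
HB.instance Definition _ := [isSub for pull0_val].
HB.instance Definition _ := [Choice of pull0 by <:].
HB.instance Definition _ := [SubChoice_isSubLmodule of pull0 by <:].

Record pull1 := Pull1 {
  pull1_val :> deg1 L * deg1 M;
  _ : pull1_val \in pull1_pred
}.
HB.instance Definition _ := [isSub for pull1_val].
HB.instance Definition _ := [Choice of pull1 by <:].
HB.instance Definition _ := [SubChoice_isSubLmodule of pull1 by <:].

Lemma pull0P (z : pull0) : hom0 f z.1 = hom0 p z.2.
Proof. by case: z => z zP; exact/eqP. Qed.

Lemma pull1P (z : pull1) : hom1 f z.1 = hom1 p z.2.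
Proof. by case: z => z zP; exact/eqP. Qed.

Lemma pull0_eq (y z : pull0) : y.1 = z.1 -> y.2 = z.2 -> y = z.
Proof.
by case: y z => [[? ?] ?] [[? ?] ?] /= e1 e2; apply: val_inj; rewrite /= e1 e2.
Qed.

Lemma pull1_eq (y z : pull1) : y.1 = z.1 -> y.2 = z.2 -> y = z.
Proof.
by case: y z => [[? ?] ?] [[? ?] ?] /= e1 e2; apply: val_inj; rewrite /= e1 e2.
Qed.

Definition mk_pull0 x y (e : hom0 f x = hom0 p y) : pull0 :=
  @Pull0 (x, y) (introT eqP e).
Definition mk_pull1 a b (e : hom1 f a = hom1 p b) : pull1 :=
  @Pull1 (a, b) (introT eqP e).

Lemma pull_diff_subproof (a : pull1) :
  hom0 f (diff L a.1) = hom0 p (diff M a.2).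
Proof. by rewrite -!hom_diff pull1P. Qed.

Lemma pull_br00_subproof (y z : pull0) :
  hom0 f (br00 y.1 z.1) = hom0 p (br00 y.2 z.2).
Proof. by rewrite !hom_br00 !pull0P. Qed.

Lemma pull_br01_subproof (y : pull0) (a : pull1) :
  hom1 f (br01 y.1 a.1) = hom1 p (br01 y.2 a.2).
Proof. by rewrite !hom_br01 pull0P pull1P. Qed.

Definition pull_diff a : pull0 := mk_pull0 (pull_diff_subproof a).
Definition pull_br00 y z : pull0 := mk_pull0 (pull_br00_subproof y z).
Definition pull_br01 y a : pull1 := mk_pull1 (pull_br01_subproof y a).

Lemma pull_diff_linear : linear pull_diff.
Proof. by move=> k a b; apply: pull0_eq; rewrite /= linearP. Qed.

HB.instance Definition _ := GRing.isLinear.Build K pull1 pull0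
  *:%R pull_diff pull_diff_linear.

Definition pull_data : lie2_data K :=
  @Lie2Data K pull0 pull1 pull_diff pull_br00 pull_br01.

Lemma pull_br00_bilinear : bilinear_for *:%R *:%R (@br00 K pull_data).
Proof.
by split=> u k y z; apply: pull0_eq; rewrite /= ?br00Pl ?br00Pr.
Qed.

Lemma pull_br01_bilinear : bilinear_for *:%R *:%R (@br01 K pull_data).
Proof.
by split=> u k y z; apply: pull1_eq; rewrite /= ?br01Pl ?br01Pr.
Qed.

Lemma pull_br00_alt (y : deg0 pull_data) : br00 y y = 0.
Proof. by apply: pull0_eq; rewrite /= br00_alt. Qed.

Lemma pull_diff_br01 (y : deg0 pull_data) (a : deg1 pull_data) :
  diff pull_data (br01 y a) = br00 y (diff pull_data a).
Proof. by apply: pull0_eq; rewrite /= diff_br01. Qed.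

Lemma pull_br01_diff (a b : deg1 pull_data) :
  br01 (diff pull_data a) b = br10 a (diff pull_data b).
Proof. by apply: pull1_eq; rewrite /= br01_diff. Qed.

Lemma pull_jacobi000 (x y z : deg0 pull_data) :
  br00 (br00 x y) z + br00 (br00 y z) x + br00 (br00 z x) y = 0.
Proof. by apply: pull0_eq; exact: jacobi000. Qed.

Lemma pull_jacobi001 (x y : deg0 pull_data) (a : deg1 pull_data) :
  br01 (br00 x y) a + br10 (br01 y a) x + br10 (br10 a x) y = 0.
Proof. by apply: pull1_eq; exact: jacobi001. Qed.

Definition pullback : strict_lie2 K :=
  StrictLie2 pull_br00_bilinear pull_br01_bilinear pull_br00_alt
    pull_diff_br01 pull_br01_diff pull_jacobi000 pull_jacobi001.

Definition pull_fst0 (z : pull0) : deg0 L := z.1.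
Definition pull_fst1 (z : pull1) : deg1 L := z.1.

Lemma pull_fst0_linear : linear pull_fst0. Proof. by []. Qed.
Lemma pull_fst1_linear : linear pull_fst1. Proof. by []. Qed.

HB.instance Definition _ := GRing.isLinear.Build K pull0 (deg0 L)
  *:%R pull_fst0 pull_fst0_linear.
HB.instance Definition _ := GRing.isLinear.Build K pull1 (deg1 L)
  *:%R pull_fst1 pull_fst1_linear.

Definition pull_fst : lie2_hom pullback L :=
  @Lie2Hom K pullback L pull_fst0 pull_fst1 (fun=> erefl) (fun _ _ => erefl)
    (fun _ _ => erefl).

Section Pairing.
Variables (P : strict_lie2 K) (u : lie2_hom P L) (v : lie2_hom P M).
Hypothesis uv0 : forall x, hom0 f (hom0 u x) = hom0 p (hom0 v x).
Hypothesis uv1 : forall a, hom1 f (hom1 u a) = hom1 p (hom1 v a).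

Definition pull_pair0 x : pull0 := mk_pull0 (uv0 x).
Definition pull_pair1 a : pull1 := mk_pull1 (uv1 a).

Lemma pull_pair0_linear : linear pull_pair0.
Proof. by move=> k x y; apply: pull0_eq; rewrite /= linearP. Qed.

Lemma pull_pair1_linear : linear pull_pair1.
Proof. by move=> k a b; apply: pull1_eq; rewrite /= linearP. Qed.

HB.instance Definition _ := GRing.isLinear.Build K (deg0 P) pull0
  *:%R pull_pair0 pull_pair0_linear.
HB.instance Definition _ := GRing.isLinear.Build K (deg1 P) pull1
  *:%R pull_pair1 pull_pair1_linear.

Lemma pull_pair_diff a : diff pullback (pull_pair1 a) = pull_pair0 (diff P a).
Proof. by apply: pull0_eq; rewrite /= hom_diff. Qed.

Lemma pull_pair_br00 x y :
  pull_pair0 (br00 x y) = @br00 K pullback (pull_pair0 x) (pull_pair0 y).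
Proof. by apply: pull0_eq; rewrite /= hom_br00. Qed.

Lemma pull_pair_br01 x a :
  pull_pair1 (br01 x a) = @br01 K pullback (pull_pair0 x) (pull_pair1 a).
Proof. by apply: pull1_eq; rewrite /= hom_br01. Qed.

(** The existence half of the universal property of the pullback. It yields both the inclusion of
    [h] into the pullback extension and the comparison map from an arbitrary extension. *)
Definition pull_pair : lie2_hom P pullback :=
  @Lie2Hom K P pullback pull_pair0 pull_pair1
    pull_pair_diff pull_pair_br00 pull_pair_br01.

End Pairing.

End Pullback.

(** * Isomorphism of extensions and invariance of the induced homomorphism *)

Section ExtensionIso.
Variables (K : fieldType) (g h : strict_lie2 K).
Implicit Types E : extension g h.

Lemma ext_iso_refl E : ext_iso E E.
Proof. by exists (lie2_id _). Qed.

Lemma ext_iso_trans E2 E1 E3 : ext_iso E1 E2 -> ext_iso E2 E3 -> ext_iso E1 E3.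
Proof.
move=> [F [Fi0 Fi1 Fp0 Fp1]] [G [Gi0 Gi1 Gp0 Gp1]]; exists (lie2_comp G F).
by split=> x /=; rewrite ?Fi0 ?Fi1 ?Gp0 ?Gp1.
Qed.

(** This is the short five lemma: a morphism of extensions that is the identity on [h] and on [g] is
    bijective in each degree, so [lie2_hom_inverse] applies. *)
Lemma ext_iso_sym E E' : ext_iso E E' -> ext_iso E' E.
Proof.
move=> [F [Fi0 Fi1 Fp0 Fp1]].
have inj0 : injective (hom0 F).
  move=> x y /eqP; rewrite -subr_eq0 -linearB => /eqP Fxy.
  apply/eqP; rewrite -subr_eq0; apply/eqP.
  have pxy : hom0 (proj E) (x - y) = 0 by rewrite -Fp0 Fxy linear0.
  (* The difference lies over 0, so it comes from some [u] in [h]; then [F] sends it to the image of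
     [u] in [E'], which vanishes only for [u = 0]. *)
  rewrite -(uninc0K pxy) in Fxy *; rewrite Fi0 in Fxy.
  by rewrite (_ : uninc0 _ = 0) ?linear0//; apply: (@incl0_inj _ _ _ E');
    rewrite Fxy linear0.
have inj1 : injective (hom1 F).
  move=> x y /eqP; rewrite -subr_eq0 -linearB => /eqP Fxy.
  apply/eqP; rewrite -subr_eq0; apply/eqP.
  have pxy : hom1 (proj E) (x - y) = 0 by rewrite -Fp1 Fxy linear0.
  rewrite -(uninc1K pxy) in Fxy *; rewrite Fi1 in Fxy.
  by rewrite (_ : uninc1 _ = 0) ?linear0//; apply: (@incl1_inj _ _ _ E');
    rewrite Fxy linear0.
have surj0 y : exists x, hom0 F x = y.
  have [x px] := proj0_surj E (hom0 (proj E') y).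
  have pyx : hom0 (proj E') (y - hom0 F x) = 0.
    by rewrite linearB /= Fp0 px subrr.
  (* The lift [x] has the right image in [g]; the remaining error [y - F x] lies in the copy of [h]
     inside [E'] and is transported back to [E]. *)
  exists (hom0 (incl E) (uninc0 (y - hom0 F x)) + x).
  by rewrite linearD /= Fi0 uninc0K// subrK.
have surj1 y : exists x, hom1 F x = y.
  have [x px] := proj1_surj E (hom1 (proj E') y).
  have pyx : hom1 (proj E') (y - hom1 F x) = 0.
    by rewrite linearB /= Fp1 px subrr.
  exists (hom1 (incl E) (uninc1 (y - hom1 F x)) + x).
  by rewrite linearD /= Fi1 uninc1K// subrK.
have [G [G0K G1K]] := lie2_hom_inverse inj0 inj1 surj0 surj1.
exists G; split.
- by move=> u; apply: inj0; rewrite G0K Fi0.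
- by move=> m; apply: inj1; rewrite G1K Fi1.
- by move=> y; rewrite -Fp0 G0K.
- by move=> b; rewrite -Fp1 G1K.
Qed.

(** Classes are predicates on extensions, so extensionality reduces their equality to [ext_iso]
    being an equivalence relation. *)
Lemma iso_class_of_eq E E' : iso_class_of E = iso_class_of E' <-> ext_iso E E'.
Proof.
split=> [[->]|iso]; first exact: ext_iso_refl.
apply: eq_exist; apply: funext => E''; apply: propext; split.
  exact/ext_iso_trans/ext_iso_sym.
exact: ext_iso_trans.
Qed.

(** Since [F] preserves brackets and matches the two copies of [h], it carries [[y, v]] to
    [[F y, v]] for [v] in [h]. *)
Lemma act0_iso E E' (F : lie2_hom (total E) (total E')) :
  (forall u, hom0 F (hom0 (incl E) u) = hom0 (incl E') u) ->
  (forall m, hom1 F (hom1 (incl E) m) = hom1 (incl E') m) ->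
  forall y, act0 (hom0 F y) = act0 y.
Proof.
move=> Fi0 Fi1 y; apply: sder0_eq => [v|m].
  by apply: (@incl0_inj _ _ _ E'); rewrite act00K -!Fi0 act00K hom_br00.
by apply: (@incl1_inj _ _ _ E'); rewrite act01K -!Fi1 act01K hom_br01.
Qed.

Lemma act1_iso E E' (F : lie2_hom (total E) (total E')) :
  (forall u, hom0 F (hom0 (incl E) u) = hom0 (incl E') u) ->
  (forall m, hom1 F (hom1 (incl E) m) = hom1 (incl E') m) ->
  forall b, act1 (hom1 F b) = act1 b.
Proof.
move=> Fi0 Fi1 b; apply: sder1_eq => v.
apply: (@incl1_inj _ _ _ E'); rewrite act10K -Fi1 act10K -Fi0.
by rewrite /br10 linearN /= hom_br01.
Qed.

(** Any lift of an element of [g] computes the induced homomorphism, not only the one given by the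
    chosen section. Read as a commuting square, this maps the total algebra into the pullback. *)
Lemma induced_hom_proj0 E y :
  hom0 (induced_hom E) (hom0 (proj E) y) = hom0 (SOut_proj h) (act0 y).
Proof. by apply: act0_proj; rewrite section0K. Qed.

Lemma induced_hom_proj1 E b :
  hom1 (induced_hom E) (hom1 (proj E) b) = hom1 (SOut_proj h) (act1 b).
Proof. by apply: act1_proj; rewrite section1K. Qed.

Lemma induced_hom_iso E E' : ext_iso E E' -> induced_hom E = induced_hom E'.
Proof.
move=> [F [Fi0 Fi1 Fp0 Fp1]]; apply: lie2_hom_ext.
  move=> x; have [y <-] := proj0_surj E x.
  (* In [E'], the lift [F y] of the same element acts on [h] exactly as [y] does. *)
  by rewrite -[in RHS]Fp0 !induced_hom_proj0 (act0_iso Fi0 Fi1).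
move=> a; have [b <-] := proj1_surj E a.
by rewrite -[in RHS]Fp1 !induced_hom_proj1 (act1_iso Fi0 Fi1).
Qed.

End ExtensionIso.

(** * The extension pulled back from the derivations along [mubar] *)

Section PullbackExtension.
Variables (K : fieldType) (g h : strict_lie2 K).
Hypothesis h_center : trivial_center h.

(** The hypothesis on the center enters through this lemma and its degree 1 analogue: the kernel of
    the adjoint is the center. *)
Lemma ad0_inj : injective (hom0 (adjoint h)).
Proof.
move=> u v /eqP; rewrite -subr_eq0 -linearB => /eqP uv.
apply/eqP; rewrite -subr_eq0; apply/eqP.
have : center0 (u - v) by [].
by rewrite h_center.2.
Qed.

Lemma ad1_inj : injective (hom1 (adjoint h)).
Proof.
move=> u v /eqP; rewrite -subr_eq0 -linearB => /eqP uv.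
apply/eqP; rewrite -subr_eq0; apply/eqP.
have : center1 (u - v) by [].
by rewrite h_center.1.
Qed.

(** Exactness of [h -> SDer h -> SOut h] in the middle, in degree 0. *)
Lemma SOut_proj0_eq0 X :
  hom0 (SOut_proj h) X = 0 <-> exists u, hom0 (adjoint h) u = X.
Proof.
rewrite -[0](linear0 (hom0 (SOut_proj h))) /=.
split=> [/eqP|[u uX]]; first by rewrite lpi_eq subr0 => /asboolP.
by apply: lpi_eqP; rewrite subr0; apply/asboolP; exists u.
Qed.

Lemma SOut_proj1_eq0 T :
  hom1 (SOut_proj h) T = 0 <-> exists m, hom1 (adjoint h) m = T.
Proof.
rewrite -[0](linear0 (hom1 (SOut_proj h))) /=.
split=> [/eqP|[u uX]]; first by rewrite lpi_eq subr0 => /asboolP.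
by apply: lpi_eqP; rewrite subr0; apply/asboolP; exists u.
Qed.

Variable mubar : lie2_hom g (SOut h).

Let P := pullback mubar (SOut_proj h).

(** It is the [g]-component of the inclusion of [h]. It is transparent because later proofs rely on
    its values computing to 0. *)
Definition lie2_zero (L M : strict_lie2 K) : lie2_hom L M.
Proof.
by exists \0 \0 => *; rewrite /= ?linear0 ?br00_0l ?br01_0l.
Defined.

Lemma pull_incl0_subproof u :
  hom0 mubar (hom0 (lie2_zero h g) u) =
  hom0 (SOut_proj h) (hom0 (adjoint h) u).
Proof. by rewrite linear0; apply/esym/SOut_proj0_eq0; exists u. Qed.

Lemma pull_incl1_subproof m :
  hom1 mubar (hom1 (lie2_zero h g) m) =
  hom1 (SOut_proj h) (hom1 (adjoint h) m).
Proof. by rewrite linear0; apply/esym/SOut_proj1_eq0; exists m. Qed.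

(** In each degree this is [u |-> (0, ad u)], which lands in the pullback because inner derivations
    vanish in [SOut h]. *)
Definition pull_incl : lie2_hom h P :=
  pull_pair pull_incl0_subproof pull_incl1_subproof.

Lemma pull_incl0_inj : injective (hom0 pull_incl).
Proof.
move=> u v /(congr1 (fun z => (pull0_val z).2)) uv.
exact: ad0_inj uv.
Qed.

Lemma pull_incl1_inj : injective (hom1 pull_incl).
Proof.
move=> u v /(congr1 (fun z => (pull1_val z).2)) uv.
exact: ad1_inj uv.
Qed.

Lemma pull_exact0 :
  range (hom0 pull_incl) =
  [set z | hom0 (pull_fst mubar (SOut_proj h)) z = 0].
Proof.
apply/seteqP; split=> [_ [u _ <-] //|z /= z1].
(* With first component 0, the second component projects to 0 in [SOut h], hence is inner. *)
have : hom0 (SOut_proj h) z.2 = 0.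
  by rewrite -pull0P (z1 : z.1 = 0) linear0.
by move=> /SOut_proj0_eq0[u uz]; exists u => //; apply: pull0_eq.
Qed.

Lemma pull_exact1 :
  range (hom1 pull_incl) =
  [set z | hom1 (pull_fst mubar (SOut_proj h)) z = 0].
Proof.
apply/seteqP; split=> [_ [u _ <-] //|z /= z1].
have : hom1 (SOut_proj h) z.2 = 0.
  by rewrite -pull1P (z1 : z.1 = 0) linear0.
by move=> /SOut_proj1_eq0[u uz]; exists u => //; apply: pull1_eq.
Qed.

Lemma pull_fst0_surj x :
  exists z, hom0 (pull_fst mubar (SOut_proj h)) z = x.
Proof.
(* A representative of the outer class [mubar x], paired with [x], is a lift of [x]. *)
have e : hom0 mubar x = hom0 (SOut_proj h) (lrepr (hom0 mubar x)).
  by rewrite /= lreprK.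
by exists (mk_pull0 e).
Qed.

Lemma pull_fst1_surj a :
  exists z, hom1 (pull_fst mubar (SOut_proj h)) z = a.
Proof.
have e : hom1 mubar a = hom1 (SOut_proj h) (lrepr (hom1 mubar a)).
  by rewrite /= lreprK.
by exists (mk_pull1 e).
Qed.

Definition pull_ext : extension g h :=
  Extension pull_incl0_inj pull_incl1_inj pull_exact0 pull_exact1
    pull_fst0_surj pull_fst1_surj.

(** In the pullback, [[(x, X), (0, ad v)] = (0, [X, ad v]) = (0, ad (X v))], so [(x, X)] acts on [h]
    by [X]. *)
Lemma act0_pull_ext (z : deg0 (total pull_ext)) :
  act0 z = (pull0_val z).2.
Proof.
apply: sder0_eq => [v|m].
  apply: (@incl0_inj _ _ _ pull_ext); rewrite act00K.
  by apply: pull0_eq; [exact: br00_0r | exact: br_ad0].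
apply: (@incl1_inj _ _ _ pull_ext); rewrite act01K.
by apply: pull1_eq; [exact: br01_0r | exact: br_ad1].
Qed.

Lemma act1_pull_ext (b : deg1 (total pull_ext)) :
  act1 b = (pull1_val b).2.
Proof.
apply: sder1_eq => v; apply: (@incl1_inj _ _ _ pull_ext); rewrite act10K.
apply: pull1_eq; last exact: br10_ad0.
by apply/eqP; rewrite oppr_eq0; apply/eqP; exact: br01_0l.
Qed.

(** A lift [(x, X)] of [x] acts by [X], and the class of [X] is [mubar x] by the equation defining
    the pullback. *)
Lemma induced_hom_pull_ext : induced_hom pull_ext = mubar.
Proof.
apply: lie2_hom_ext => [x|a].
  have [z <-] := proj0_surj pull_ext x.
  by rewrite induced_hom_proj0 act0_pull_ext -pull0P.
have [b <-] := proj1_surj pull_ext a.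
by rewrite induced_hom_proj1 act1_pull_ext -pull1P.
Qed.

End PullbackExtension.

(** * Comparison of an extension with its pullback, and the bijection *)

Section Classification.
Variables (K : fieldType) (g h : strict_lie2 K).
Hypothesis h_center : trivial_center h.
Implicit Types E : extension g h.

Definition act_hom E : lie2_hom (total E) (SDer h) :=
  @Lie2Hom K (total E) (SDer h) (@act0 K g h E) (@act1 K g h E)
    (@act_diff K g h E) (@act_br00 K g h E) (@act_br01 K g h E).

(** The map is [y |-> (proj y, act y)]; on [h] it is [u |-> (0, ad u)], the inclusion of the
    pullback extension. *)
Lemma ext_iso_pull_ext E : ext_iso E (pull_ext h_center (induced_hom E)).
Proof.
exists (pull_pair (v := act_hom E) (@induced_hom_proj0 _ _ _ E)
  (@induced_hom_proj1 _ _ _ E)); split=> //.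
- by move=> u; apply: pull0_eq; [exact: projK0 | exact: act0_incl].
- by move=> m; apply: pull1_eq; [exact: projK1 | exact: act1_incl].
Qed.

End Classification.

Theorem proposition5p1 (K : fieldType) (g h : strict_lie2 K)
    (h_center : trivial_center h) :
  exists Phi : iso_class g h -> lie2_hom g (SOut h),
    (forall E : extension g h, Phi (iso_class_of E) = induced_hom E) /\
    bijective Phi.
Proof.
have rep (C : iso_class g h) : exists E, C = iso_class_of E.
  by case: C => C [E CE]; exists E; exact: eq_exist.
(* The value is read off a chosen representative; [induced_hom_iso] makes it independent of that
   choice. *)
pose Phi C := induced_hom (sval (cid (rep C))).
have PhiE E : Phi (iso_class_of E) = induced_hom E.
  rewrite /Phi; case: (cid _) => E' /= /iso_class_of_eq EE'.
  exact/esym/induced_hom_iso.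
exists Phi; split=> //.
(* The inverse sends [mubar] to the class of its pullback extension. *)
exists (fun mubar => iso_class_of (pull_ext h_center mubar)) => [C|mubar].
  have [E ->] := rep C; rewrite PhiE.
  exact/iso_class_of_eq/ext_iso_sym/ext_iso_pull_ext.
by rewrite PhiE; exact: induced_hom_pull_ext.
Qed.
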